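(* Let $f:S\to\bar S$ be an isometry of smooth surfaces immersed in $\mathbb{R}^3$. If $\alpha$ and $\bar\alpha$ are respectively osculating curves on $S$ and $\bar S$, where $\bar\alpha=f\circ\alpha$, then the component of the osculating curve $\alpha(s)$ along $\vec T\times\vec N$ is invariant, i.e. $$\alpha\cdot(\vec T\times\vec N)=\bar\alpha\cdot(\vec{\bar T}\times\vec{\bar N}).$$
   Context: An isometry $f:S\to\bar S$ is a diffeomorphism preserving the length of every curve. Let $\phi(u,v)$ be a surface patch of $S$ and $\bar\phi=f\circ\phi$ the corresponding patch of $\bar S$. The curve $\alpha(s)=\phi(u(s),v(s))$ is parametrized by arc length. A curve is osculating if its position vector lies in the plane spanned by its unit tangent $\vec t$ and principal normal $\vec n$, i.e. $\alpha=\lambda_1\vec t+\lambda_2\vec n$ for some functions $\lambda_1,\lambda_2$. $\vec T=a\phi_u+b\phi_v$ ($a,b\in\mathbb{R}$) denotes any tangent vector to $S$ at $\alpha(s)$, $\vec{\bar T}=a\bar\phi_u+b\bar\phi_v$ is the corresponding tangent vector to $\bar S$, and $\vec N,\vec{\bar N}$ are the unit normals to $S,\bar S$ (in the directions of $\phi_u\times\phi_v$ and $\bar\phi_u\times\bar\phi_v$).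
   Formalization: The formal theorem assumes that the coefficient functions λ₁, λ₂ are the same for α and ᾱ; without this the claim fails, e.g. for the unit circle in the plane z=0 translated by e₁. *)

(* Defs.v *)
(* Standard library reals with Coquelicot. *)
From Stdlib Require Import Reals.
From Coquelicot Require Import Coquelicot.
Open Scope R_scope.

(** ** Vectors of R^3 *)

(* [plus], [scal] and [zero] on this type are those of Coquelicot's product
   module. *)
Notation R3 := (R * R * R)%type.

Definition coord1 (p : R3) : R := fst (fst p).
Definition coord2 (p : R3) : R := snd (fst p).
Definition coord3 (p : R3) : R := snd p.

Definition dot (p q : R3) : R := coord1 p * coord1 q + coord2 p * coord2 q + coord3 p * coord3 q.

Definition cross (p q : R3) : R3 :=
  (coord2 p * coord3 q - coord3 p * coord2 q,
   coord3 p * coord1 q - coord1 p * coord3 q,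
   coord1 p * coord2 q - coord2 p * coord1 q).

Definition norm3 (p : R3) : R := sqrt (dot p p).

Definition normalize (p : R3) : R3 := scal (/ norm3 p) p.

(** ** Smoothness and derivatives *)

Definition smooth1 (I : R -> Prop) (f : R -> R) : Prop :=
  forall (n : nat) (t : R), I t -> ex_derive_n f n t.

(* [ex_diff_n f n x y] is a condition at the point (x, y) only; required for
   all n at all points of an open set W, it says that f is C^infinity on W. *)
Definition smooth2 (W : R * R -> Prop) (f : R * R -> R) : Prop :=
  forall (n : nat) (x y : R), W (x, y) -> ex_diff_n (fun a b => f (a, b)) n x y.

Definition smooth2_R2 (W : R * R -> Prop) (g : R * R -> R * R) : Prop :=
  smooth2 W (fun p => fst (g p)) /\ smooth2 W (fun p => snd (g p)).

Definition smooth2_R3 (W : R * R -> Prop) (g : R * R -> R3) : Prop :=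
  smooth2 W (fun p => coord1 (g p)) /\ smooth2 W (fun p => coord2 (g p)) /\
  smooth2 W (fun p => coord3 (g p)).

Definition velocity (gamma : R -> R3) (t : R) : R3 :=
  (Derive (fun s => coord1 (gamma s)) t,
   Derive (fun s => coord2 (gamma s)) t,
   Derive (fun s => coord3 (gamma s)) t).

Definition partial_u (phi : R * R -> R3) (p : R * R) : R3 :=
  velocity (fun x => phi (x, snd p)) (fst p).

Definition partial_v (phi : R * R -> R3) (p : R * R) : R3 :=
  velocity (fun y => phi (fst p, y)) (snd p).

Definition unit_normal (phi : R * R -> R3) (p : R * R) : R3 :=
  normalize (cross (partial_u phi p) (partial_v phi p)).

(** ** Smooth surfaces immersed in R^3 *)

Record chart (M : Type) : Type := Chart {
  dom : R * R -> Prop;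
  param : R * R -> M
}.
Arguments dom {M} _ _.
Arguments param {M} _ _.

(* The local expression d^-1 o h o c of h is smooth on its domain of
   definition, and that domain is open. *)
Definition smooth_in_charts {M N : Type} (h : M -> N)
    (c : chart M) (d : chart N) : Prop :=
  let W := fun p => dom c p /\ exists q, dom d q /\ param d q = h (param c p) in
  open W /\
  exists g : R * R -> R * R,
    smooth2_R2 W g /\
    forall p, W p -> dom d (g p) /\ param d (g p) = h (param c p).

(* An abstract smooth 2-manifold, given by an atlas of injective
   parametrizations by open sets of R^2, with a smooth immersion into R^3.
   Neither injectivity of the immersion nor maximality of the atlas is
   required; a surface contained in R^3 is the case where [immersion] is an
   inclusion.  The surface patch phi attached to a chart c is
   [immersion o param c]. *)
Record surface : Type := Surface {
  pt : Type;
  atlas : chart pt -> Prop;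
  immersion : pt -> R3;
  atlas_open : forall c, atlas c -> open (dom c);
  atlas_inj : forall c, atlas c -> forall p q, dom c p -> dom c q ->
    param c p = param c q -> p = q;
  atlas_cover : forall x, exists c p, atlas c /\ dom c p /\ param c p = x;
  atlas_compat : forall c d, atlas c -> atlas d ->
    smooth_in_charts (fun x : pt => x) c d;
  immersion_smooth : forall c, atlas c ->
    smooth2_R3 (dom c) (fun p => immersion (param c p));
  immersion_regular : forall c, atlas c -> forall p, dom c p ->
    cross (partial_u (fun q => immersion (param c q)) p)
          (partial_v (fun q => immersion (param c q)) p) <> zero
}.

(** ** Isometries *)

Definition smooth_map (S S' : surface) (f : pt S -> pt S') : Prop :=
  forall c d, atlas S c -> atlas S' d -> smooth_in_charts f c d.

Definition diffeomorphism (S S' : surface) (f : pt S -> pt S') : Prop :=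
  smooth_map S S' f /\
  exists g : pt S' -> pt S, smooth_map S' S g /\
    (forall x, g (f x) = x) /\ (forall y, f (g y) = y).

Definition Rbar_interval (lo hi : Rbar) (t : R) : Prop :=
  Rbar_lt lo t /\ Rbar_lt t hi.

Definition smooth_curve (S : surface) (I : R -> Prop) (gamma : R -> pt S)
    : Prop :=
  forall c, atlas S c ->
    let W := fun t => I t /\ exists p, dom c p /\ param c p = gamma t in
    open W /\
    exists u v : R -> R, smooth1 W u /\ smooth1 W v /\
      forall t, W t -> dom c (u t, v t) /\ param c (u t, v t) = gamma t.

Definition arc_length (gamma : R -> R3) (a b : R) : R :=
  RInt (fun t => norm3 (velocity gamma t)) a b.

Definition isometry (S S' : surface) (f : pt S -> pt S') : Prop :=
  diffeomorphism S S' f /\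
  forall (lo hi : Rbar) (gamma : R -> pt S) (a b : R),
    smooth_curve S (Rbar_interval lo hi) gamma ->
    Rbar_interval lo hi a -> Rbar_interval lo hi b -> a <= b ->
    arc_length (fun t => immersion S' (f (gamma t))) a b
    = arc_length (fun t => immersion S (gamma t)) a b.

(** ** Osculating curves *)

Definition unit_speed (I : R -> Prop) (gamma : R -> R3) : Prop :=
  forall s, I s -> norm3 (velocity gamma s) = 1.

Definition unit_tangent (gamma : R -> R3) (s : R) : R3 :=
  normalize (velocity gamma s).

Definition principal_normal (gamma : R -> R3) (s : R) : R3 :=
  normalize (velocity (unit_tangent gamma) s).

(* The principal normal exists only where the derivative of the unit tangent
   does not vanish, hence the first conjunct. *)
Definition osculating_with (I : R -> Prop) (lambda1 lambda2 : R -> R)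
    (gamma : R -> R3) : Prop :=
  forall s, I s ->
    velocity (unit_tangent gamma) s <> zero /\
    gamma s = plus (scal (lambda1 s) (unit_tangent gamma s))
                   (scal (lambda2 s) (principal_normal gamma s)).

(* A curve is osculating when such coefficient functions exist.  For a pair of
   curves corresponding under an isometry the coefficient functions are meant
   to be common to both, the frames alone being changed.  With unrelated
   coefficients the invariance of the component along T x N fails: translating
   the plane z = 0 by e1 is an isometry which maps the unit circle
   (cos s, sin s, 0) to (1 + cos s, sin s, 0); both circles are osculating, but
   for T = phi_v, so that T x N = e1, the components are cos s and 1 + cos s. *)
Definition osculating_pair (I : R -> Prop) (gamma gamma' : R -> R3) : Prop :=
  exists lambda1 lambda2 : R -> R,
    osculating_with I lambda1 lambda2 gamma /\
    osculating_with I lambda1 lambda2 gamma'.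

Definition tangent_vector (phi : R * R -> R3) (a b : R) (p : R * R) : R3 :=
  plus (scal a (partial_u phi p)) (scal b (partial_v phi p)).

(* Main.v *)
(** Write [alpha = l1 t + l2 n].  Comparing the lengths of straight lines in a
    chart shows that the first fundamental form is preserved.  As
    [alpha . (T x N)] is
    [((alpha . phi_u) (T . phi_v) - (alpha . phi_v) (T . phi_u)) / |phi_u x phi_v|],
    it remains to compare [alpha . phi_u] and [alpha . phi_v] on both surfaces.
    With [kappa = |alpha''|], they are combinations, with coefficients [l1] and
    [l2 / kappa], of the products of [alpha'] and [alpha''] with [phi_u] and
    [phi_v], and those are intrinsic (Christoffel symbols).  The curvature
    [kappa] itself is not intrinsic, but [l2 kappa] is determined by [l1]: as
    [l1 = alpha . alpha'], one has [l1' = 1 + l2 kappa].  So the two curves have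
    the same curvature wherever [l2 <> 0]. *)
Require Import Defs.
From Stdlib Require Import Reals Lra.
From Coquelicot Require Import Coquelicot.
Open Scope R_scope.

(** * Functions of class C^n of two variables *)

(** Differentiability in the Fréchet sense rather than the existence of partial derivatives: this is
    what the chain rule along curves requires. *)
Definition has_grad (f : R * R -> R) (p : R * R) (lu lv : R) : Prop :=
  differentiable_pt_lim (fun x y => f (x, y)) (fst p) (snd p) lu lv.

(* The partial derivatives are quantified existentially rather than given by
   [Derive], so that closure under sums, products and composition needs no
   extensionality at lower orders. *)
Fixpoint class_C (n : nat) (W : R * R -> Prop) (f : R * R -> R) : Prop :=
  match n with
  | O => forall p, W p -> continuous f p
  | S m => exists fu fv : R * R -> R,
      (forall p, W p -> has_grad f p (fu p) (fv p)) /\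
      class_C m W fu /\ class_C m W fv
  end.

Definition Derive_u (f : R * R -> R) (p : R * R) : R :=
  Derive (fun x => f (x, snd p)) (fst p).
Definition Derive_v (f : R * R -> R) (p : R * R) : R :=
  Derive (fun y => f (fst p, y)) (snd p).

Lemma has_grad_unique f p lu lv : has_grad f p lu lv -> Derive_u f p = lu /\ Derive_v f p = lv.
Proof. exact (differentiable_pt_lim_unique _ _ _ _ _). Qed.

Lemma has_grad_ext f g p lu lv :
  locally p (fun q => f q = g q) -> has_grad f p lu lv -> has_grad g p lu lv.
Proof.
  intros E. apply differentiable_pt_lim_ext. destruct p as [x y].
  apply locally_2d_locally. revert E. apply filter_imp. now intros [a b].
Qed.

Lemma has_grad_continuous f p lu lv : has_grad f p lu lv -> continuous f p.
Proof.
  destruct p as [x y]. intros H. apply filterdiff_differentiable_pt_lim in H.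
  apply (continuous_ext (fun q : R * R => f (fst q, snd q))); [now intros [a b]|].
  apply (filterdiff_continuous (K := R_AbsRing)
    (U := prod_NormedModule _ R_NormedModule R_NormedModule) (fun q : R * R => f (fst q, snd q))).
  eexists. exact H.
Qed.

Lemma has_grad_partials f p lu lv : has_grad f p lu lv ->
  is_derive (fun x => f (x, snd p)) (fst p) lu /\
  is_derive (fun y => f (fst p, y)) (snd p) lv.
Proof.
  intros H; split; apply is_derive_Reals.
  - replace lu with (lu * 1 + lv * 0) by ring.
    apply (derivable_pt_lim_comp_2d (fun x y => f (x, y)) (fun t => t) (fun _ => snd p)).
    + exact H.
    + apply derivable_pt_lim_id.
    + apply derivable_pt_lim_const.
  - replace lv with (lu * 0 + lv * 1) by ring.
    apply (derivable_pt_lim_comp_2d (fun x y => f (x, y)) (fun _ => fst p) (fun t => t)).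
    + exact H.
    + apply derivable_pt_lim_const.
    + apply derivable_pt_lim_id.
Qed.

Lemma has_grad_curve f (u v : R -> R) t u' v' :
  has_grad f (u t, v t) (Derive_u f (u t, v t)) (Derive_v f (u t, v t)) ->
  is_derive u t u' -> is_derive v t v' ->
  is_derive (fun s => f (u s, v s)) t
    (u' * Derive_u f (u t, v t) + v' * Derive_v f (u t, v t)).
Proof.
  intros Hf Hu Hv. apply is_derive_Reals.
  rewrite (Rmult_comm u'), (Rmult_comm v').
  apply (derivable_pt_lim_comp_2d (fun x y => f (x, y)) u v);
    [exact Hf | now apply is_derive_Reals ..].
Qed.

(** Openness turns equality on [W] into equality near each of its points. Only the top level
    changes: the witnesses [fu], [fv] for [f] serve for [g] too, so no induction is required. *)
Lemma class_C_ext n (W : R * R -> Prop) f g : open W -> (forall p, W p -> f p = g p) ->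
  class_C n W f -> class_C n W g.
Proof.
  intros HW E.
  assert (L : forall p, W p -> locally p (fun q => f q = g q)).
  { intros p Hp. generalize (HW p Hp). now apply filter_imp. }
  destruct n as [|n]; simpl.
  - intros H p Hp. apply (continuous_ext_loc _ f); [now apply L | now apply H].
  - intros (fu & fv & H & H1 & H2). exists fu, fv. repeat split; trivial.
    intros p Hp. apply (has_grad_ext f); [now apply L | now apply H].
Qed.

Lemma class_C_partials n (W : R * R -> Prop) f : open W -> class_C (S n) W f ->
  (forall p, W p -> has_grad f p (Derive_u f p) (Derive_v f p)) /\
  class_C n W (Derive_u f) /\ class_C n W (Derive_v f).
Proof.
  intros HW (fu & fv & H & H1 & H2).
  assert (E : forall p, W p -> Derive_u f p = fu p /\ Derive_v f p = fv p)
    by (intros p Hp; now apply has_grad_unique, H).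
  repeat split.
  - intros p Hp. destruct (E p Hp) as [-> ->]. now apply H.
  - apply (class_C_ext n W fu); trivial. intros p Hp. symmetry. now apply E.
  - apply (class_C_ext n W fv); trivial. intros p Hp. symmetry. now apply E.
Qed.

(** The derivatives provided on the various [V] have to be glued into functions on all of [W].
    [Derive_u f] and [Derive_v f] do so, since they do not depend on [V] and agree with the local
    witnesses by uniqueness. *)
Lemma class_C_local n (W : R * R -> Prop) f :
  (forall p, W p -> exists V : R * R -> Prop, open V /\ V p /\ class_C n V f) ->
  class_C n W f.
Proof.
  revert f. induction n as [|n IH]; intros f H.
  - intros p Hp. destruct (H p Hp) as (V & _ & Vp & C). now apply C.
  - exists (Derive_u f), (Derive_v f). repeat split.
    + intros p Hp. destruct (H p Hp) as (V & HV & Vp & C).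
      now apply (class_C_partials n V f).
    + apply IH. intros p Hp. destruct (H p Hp) as (V & HV & Vp & C).
      exists V. repeat split; trivial. now apply class_C_partials.
    + apply IH. intros p Hp. destruct (H p Hp) as (V & HV & Vp & C).
      exists V. repeat split; trivial. now apply class_C_partials.
Qed.

Lemma class_C_pred n (W : R * R -> Prop) f : class_C (S n) W f -> class_C n W f.
Proof.
  revert f. induction n as [|n IH]; intros f (fu & fv & H & H1 & H2).
  - intros p Hp. exact (has_grad_continuous _ _ _ _ (H p Hp)).
  - exists fu, fv. auto.
Qed.

Lemma class_C_plus n (W : R * R -> Prop) f g : class_C n W f -> class_C n W g ->
  class_C n W (fun p => f p + g p).
Proof.
  revert f g. induction n as [|n IH]; intros f g.
  - intros Hf Hg p Hp. apply (continuous_plus f g); auto.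
  - intros (fu & fv & Hf & Hf1 & Hf2) (gu & gv & Hg & Hg1 & Hg2).
    exists (fun p => fu p + gu p), (fun p => fv p + gv p).
    repeat split; auto. intros p Hp.
    assert (A : differentiable_pt_lim Rplus (f p) (g p) 1 1).
    { apply filterdiff_differentiable_pt_lim.
      generalize (filterdiff_plus (K := R_AbsRing) (V := R_NormedModule) (locally (f p, g p))).
      intros A. eapply filterdiff_ext_lin. exact A. intros [a b]; simpl; unfold plus; simpl; ring. }
    unfold has_grad.
    replace (fu p + gu p) with (1 * fu p + 1 * gu p) by ring.
    replace (fv p + gv p) with (1 * fv p + 1 * gv p) by ring.
    apply (differentiable_pt_lim_comp Rplus (fun x y => f (x, y)) (fun x y => g (x, y)));
      [rewrite <- (surjective_pairing p); exact A | now apply Hf | now apply Hg].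
Qed.

Lemma class_C_mult n (W : R * R -> Prop) f g : class_C n W f -> class_C n W g ->
  class_C n W (fun p => f p * g p).
Proof.
  revert f g. induction n as [|n IH]; intros f g.
  - intros Hf Hg p Hp. apply (continuous_mult f g); auto.
  (* The product rule brings back [f] and [g] themselves, so both are also kept at order [n] for the
     induction hypothesis. *)
  - intros Cf Cg. generalize (class_C_pred _ _ _ Cf) (class_C_pred _ _ _ Cg).
    intros Cf' Cg'. destruct Cf as (fu & fv & Hf & Hf1 & Hf2).
    destruct Cg as (gu & gv & Hg & Hg1 & Hg2).
    exists (fun p => g p * fu p + f p * gu p), (fun p => g p * fv p + f p * gv p).
    repeat split; try (apply class_C_plus; auto). intros p Hp.
    (* The product rule is the chain rule for the two-variable function [Rmult], whose gradient at
       [(f p, g p)] is [(g p, f p)]. *)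
    assert (A : differentiable_pt_lim Rmult (f p) (g p) (g p) (f p)).
    { apply filterdiff_differentiable_pt_lim.
      eapply filterdiff_ext_lin.
      - apply (filterdiff_mult (K := R_AbsRing) (F := locally (f p, g p)) (f p, g p)).
        + intros P HP; exact HP.
        + intros; apply Rmult_comm.
      - intros [a b]; simpl; unfold plus, mult; simpl; ring. }
    apply (differentiable_pt_lim_comp Rmult (fun x y => f (x, y)) (fun x y => g (x, y)));
      [rewrite <- (surjective_pairing p); exact A | now apply Hf | now apply Hg].
Qed.

Lemma class_C_const n (W : R * R -> Prop) (k : R) : class_C n W (fun _ => k).
Proof.
  revert k. induction n as [|n IH]; intros k.
  - intros p _. apply continuous_const.
  - exists (fun _ => 0), (fun _ => 0). repeat split; auto. intros p _.
    apply filterdiff_differentiable_pt_lim.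
    eapply filterdiff_ext_lin; [apply filterdiff_const|].
    intros y; unfold zero; simpl; ring.
Qed.

Lemma class_C_comp n (W V : R * R -> Prop) f (g : R * R -> R * R) :
  (forall p, W p -> V (g p)) ->
  class_C n V f ->
  class_C n W (fun p => fst (g p)) -> class_C n W (fun p => snd (g p)) ->
  class_C n W (fun p => f (g p)).
Proof.
  intros HV. revert f. induction n as [|n IH]; intros f.
  - intros Hf H1 H2 p Hp.
    apply (continuous_ext (fun p => f (fst (g p), snd (g p)))).
    { intros q. now rewrite <- surjective_pairing. }
    apply (continuous_comp_2 (fun p => fst (g p)) (fun p => snd (g p)) (fun x y => f (x, y)));
      [now apply H1 | now apply H2 |].
    apply (continuous_ext f); [now intros [a b]|].
    rewrite <- surjective_pairing. now apply Hf, HV.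
  - intros (fu & fv & Hf & Hf1 & Hf2) C1 C2.
    generalize (class_C_pred _ _ _ C1) (class_C_pred _ _ _ C2). intros C1' C2'.
    destruct C1 as (au & av & Ha & Ha1 & Ha2).
    destruct C2 as (bu & bv & Hb & Hb1 & Hb2).
    exists (fun p => fu (g p) * au p + fv (g p) * bu p),
           (fun p => fu (g p) * av p + fv (g p) * bv p).
    repeat split; try (apply class_C_plus; apply class_C_mult; auto).
    intros p Hp.
    apply (has_grad_ext (fun p => f (fst (g p), snd (g p)))).
    { apply filter_forall. intros q. now rewrite <- surjective_pairing. }
    apply (differentiable_pt_lim_comp (fun x y => f (x, y)) (fun x y => fst (g (x, y)))
             (fun x y => snd (g (x, y)))); [| now apply Ha | now apply Hb].
    rewrite <- (surjective_pairing p). now apply Hf, HV.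
Qed.

(** * From iterated partial derivatives to class C^n, and the symmetry of mixed derivatives *)

Lemma continuity_2d_pt_continuous f p :
  continuity_2d_pt (fun x y => f (x, y)) (fst p) (snd p) -> continuous f p.
Proof.
  destruct p as [x y]. intros H. apply continuity_2d_pt_filterlim in H.
  apply (continuous_ext (fun q : R * R => f (fst q, snd q))); [now intros [a b]|exact H].
Qed.

Lemma continuous_continuity_2d_pt f p :
  continuous f p -> continuity_2d_pt (fun x y => f (x, y)) (fst p) (snd p).
Proof.
  destruct p as [x y]. intros H. apply continuity_2d_pt_filterlim.
  apply (continuous_ext f (fun q : R * R => f (fst q, snd q)));
    [now intros [a b] | exact H].
Qed.

Lemma smooth2_class_C n (W : R * R -> Prop) f : open W -> smooth2 W f -> class_C n W f.
Proof.
  intros HW. revert f. induction n as [|n IH]; intros f H.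
  - intros [x y] Hp. apply continuity_2d_pt_continuous. exact (proj1 (H O x y Hp)).
  - exists (Derive_u f), (Derive_v f). repeat split.
    + intros [x y] Hp. apply filterdiff_differentiable_pt_lim.
      (* Differentiability follows from the u-derivative near the point, its continuity there, and
         the v-derivative at the point alone. The continuity is the first conjunct of [ex_diff_n]
         for the u-derivative. *)
      apply (is_derive_filterdiff (fun x y => f (x, y)) x y (fun a b => Derive_u f (a, b))).
      * generalize (HW _ Hp). apply filter_imp. intros [a b] Hq.
        apply Derive_correct, (H 1%nat a b Hq).
      * apply (Derive_correct (fun y => f (x, y))), (H 1%nat x y Hp).
      * apply (continuous_ext (Derive_u f)); [now intros [a b]|].
        apply continuity_2d_pt_continuous.
        exact (proj1 (proj1 (proj2 (proj2 (proj2 (H 1%nat x y Hp)))))).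
    + apply IH. intros k x y Hp. apply (H (S k) x y Hp).
    + apply IH. intros k x y Hp. apply (H (S k) x y Hp).
Qed.

Lemma class_C_Schwarz (W : R * R -> Prop) f p : open W -> class_C 2 W f -> W p ->
  Derive_u (Derive_v f) p = Derive_v (Derive_u f) p.
Proof.
  intros HW H Hp.
  destruct (class_C_partials _ _ _ HW H) as (G & Gu & Gv).
  destruct (class_C_partials _ _ _ HW Gu) as (Du & Duu & Duv).
  destruct (class_C_partials _ _ _ HW Gv) as (Dv & Dvu & Dvv).
  apply (Schwarz (fun x y => f (x, y)) (fst p) (snd p)).
  - apply locally_2d_locally. rewrite <- surjective_pairing.
    generalize (HW p Hp). apply filter_imp. intros q Hq.
    repeat split; eexists.
    + apply (has_grad_partials f q _ _ (G q Hq)).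
    + apply (has_grad_partials f q _ _ (G q Hq)).
    + apply (has_grad_partials (Derive_v f) q _ _ (Dv q Hq)).
    + apply (has_grad_partials (Derive_u f) q _ _ (Du q Hq)).
  - apply (continuous_continuity_2d_pt (Derive_u (Derive_v f))), Dvu, Hp.
  - apply (continuous_continuity_2d_pt (Derive_v (Derive_u f))), Duv, Hp.
Qed.

(** * Straight lines in a chart *)

(** [ex_derive_n] takes the last derivative outermost, whereas inductions on the order take the
    first one innermost. [Derive_n_comp] exchanges the two views. *)
Lemma ex_derive_n_of_derivative (V : R -> Prop) F G n t : open V ->
  (forall r, V r -> is_derive F r (G r)) -> V t ->
  ex_derive_n G n t -> ex_derive_n F (S n) t.
Proof.
  intros HV H Ht HG. destruct n as [|n]; simpl.
  - exists (G t). now apply H.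
  - apply (ex_derive_ext_loc (Derive_n G n)); [|exact HG].
    apply (locally_open V); trivial. intros r Hr.
    change (Derive (Derive_n F n) r) with (Derive_n F (S n) r).
    replace (S n) with (n + 1)%nat by apply Nat.add_1_r.
    rewrite <- Derive_n_comp. apply Derive_n_ext_loc.
    apply (locally_open V); trivial. intros a Ha.
    symmetry. apply is_derive_unique, (H a Ha).
Qed.

Definition line (p d : R * R) (t : R) : R * R := (fst p + t * fst d, snd p + t * snd d).

Lemma line_is_derive (a b t : R) : is_derive (fun s => a + s * b) t b.
Proof. auto_derive; trivial; ring. Qed.

Lemma line_continuous p d t : continuous (line p d) t.
Proof.
  unfold line.
  apply (continuous_comp_2 (fun s => fst p + s * fst d) (fun s => snd p + s * snd d) pair).
  - apply (ex_derive_continuous (K := R_AbsRing) (V := R_NormedModule)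
      (fun s => fst p + s * fst d)).
    eexists. apply line_is_derive.
  - apply (ex_derive_continuous (K := R_AbsRing) (V := R_NormedModule)
      (fun s => snd p + s * snd d)).
    eexists. apply line_is_derive.
  - apply (continuous_ext (fun q : R * R => q)); [now intros [a b] | apply continuous_id].
Qed.

Lemma open_line (W : R * R -> Prop) p d : open W -> open (fun t => W (line p d t)).
Proof. intros HW. apply open_comp; trivial. intros t _. apply line_continuous. Qed.

Lemma has_grad_line f p d t :
  has_grad f (line p d t) (Derive_u f (line p d t)) (Derive_v f (line p d t)) ->
  is_derive (fun s => f (line p d s)) t
    (fst d * Derive_u f (line p d t) + snd d * Derive_v f (line p d t)).
Proof.
  intros H. apply (has_grad_curve f (fun s => fst p + s * fst d) (fun s => snd p + s * snd d));
    [exact H | apply line_is_derive ..].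
Qed.

(** Differentiating along a line gives a combination of the partial derivatives with constant
    coefficients, again restricted to the line, so the induction closes. *)
Lemma class_C_line n (W : R * R -> Prop) f p d t : open W -> class_C n W f -> W (line p d t) ->
  ex_derive_n (fun s => f (line p d s)) n t.
Proof.
  intros HW. revert f. induction n as [|n IH]; intros f Hf Ht; [exact I|].
  destruct (class_C_partials _ _ _ HW Hf) as (Hg & Hu & Hv).
  apply (ex_derive_n_of_derivative (fun s => W (line p d s)) _
    (fun s => fst d * Derive_u f (line p d s) + snd d * Derive_v f (line p d s))); trivial.
  - now apply open_line.
  - intros r Hr. now apply has_grad_line, Hg.
  - apply (IH (fun q => fst d * Derive_u f q + snd d * Derive_v f q)); trivial.
    apply class_C_plus; apply class_C_mult; trivial; apply class_C_const.
Qed.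

Lemma open_Rbar_interval lo hi : open (Rbar_interval lo hi).
Proof. apply open_and; [apply open_Rbar_gt | apply open_Rbar_lt]. Qed.

(** [smooth_curve] must be tested in every chart [e]. There the curve is the image of the line under
    the transition map [g] from [c] to [e], defined on the open set [W2]. *)
Lemma smooth_curve_line (S : surface) c p d lo hi : atlas S c ->
  (forall t, Rbar_interval lo hi t -> dom c (line p d t)) ->
  smooth_curve S (Rbar_interval lo hi) (fun t => param c (line p d t)).
Proof.
  intros Hc HI e He W.
  destruct (atlas_compat S c e Hc He) as (HW & g & (G1 & G2) & Hg).
  set (W2 := fun p => dom c p /\ exists q, dom e q /\ param e q = param c p) in *.
  assert (HW12 : forall t, W t -> W2 (line p d t)).
  { intros t (It & q & Hq). split; [now apply HI | now exists q]. }
  split; [|exists (fun t => fst (g (line p d t))), (fun t => snd (g (line p d t)))].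
  - intros t (It & q & Hq).
    assert (L := open_and _ _ (open_Rbar_interval lo hi) (open_line W2 p d HW)).
    assert (A : locally t (fun r => Rbar_interval lo hi r /\ W2 (line p d r))).
    { apply L. split; trivial. split; [now apply HI | now exists q]. }
    revert A. apply filter_imp. intros r (Ir & _ & E). now split.
  - repeat split.
    + intros n t Ht. apply (class_C_line n W2 (fun q => fst (g q))); auto.
      now apply smooth2_class_C.
    + intros n t Ht. apply (class_C_line n W2 (fun q => snd (g q))); auto.
      now apply smooth2_class_C.
    + rewrite <- surjective_pairing. apply (Hg _ (HW12 _ H)).
    + rewrite <- surjective_pairing. apply (Hg _ (HW12 _ H)).
Qed.

(** * Regularity of the patches of both surfaces *)

Definition class_C3 (n : nat) (W : R * R -> Prop) (phi : R * R -> R3) : Prop :=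
  class_C n W (fun p => coord1 (phi p)) /\ class_C n W (fun p => coord2 (phi p)) /\
  class_C n W (fun p => coord3 (phi p)).

Lemma class_C3_chart (S : surface) c n : atlas S c ->
  class_C3 n (dom c) (fun p => immersion S (param c p)).
Proof.
  intros Hc. generalize (immersion_smooth S c Hc) (atlas_open S c Hc).
  intros (H1 & H2 & H3) Ho. repeat split; now apply smooth2_class_C.
Qed.

(** The composite of [f] with a chart of [S] need not lie in one chart of [S']. Near each point it
    factors through some chart [e] of [S'] and a smooth local expression [g]; [class_C_local] then
    glues the pieces. *)
Lemma class_C3_smooth_map (S S' : surface) (f : pt S -> pt S') c n :
  smooth_map S S' f -> atlas S c ->
  class_C3 n (dom c) (fun p => immersion S' (f (param c p))).
Proof.
  intros Hf Hc.
  assert (H : forall p, dom c p -> exists V : R * R -> Prop, open V /\ V p /\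
    class_C3 n V (fun p => immersion S' (f (param c p)))).
  { intros p Hp.
    destruct (atlas_cover S' (f (param c p))) as (e & q & He & Hq & E).
    destruct (Hf c e Hc He) as (HW & g & (G1 & G2) & Hg).
    eexists; split; [exact HW|]. split; [split; [trivial | now exists q]|].
    destruct (class_C3_chart S' e n He) as (C1 & C2 & C3).
    assert (K : forall h : R3 -> R,
      class_C n (dom e) (fun p => h (immersion S' (param e p))) ->
      class_C n (fun p => dom c p /\ exists q, dom e q /\ param e q = f (param c p))
        (fun p => h (immersion S' (f (param c p))))).
    { intros h Ch. eapply class_C_ext; [exact HW| |
        apply (class_C_comp n _ (dom e) (fun p => h (immersion S' (param e p))) g)].
      - intros r Hr. simpl. now rewrite (proj2 (Hg r Hr)).
      - intros r Hr. apply (Hg r Hr).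
      - exact Ch.
      - now apply smooth2_class_C.
      - now apply smooth2_class_C. }
    now repeat split; apply K. }
  repeat split; apply class_C_local; intros p Hp;
    destruct (H p Hp) as (V & HV & Vp & C1 & C2 & C3); now exists V.
Qed.

(** * Vector calculus *)

Lemma coord_plus (p q : R3) : coord1 (plus p q) = coord1 p + coord1 q /\
  coord2 (plus p q) = coord2 p + coord2 q /\ coord3 (plus p q) = coord3 p + coord3 q.
Proof. now repeat split. Qed.

Lemma coord_scal k (p : R3) : coord1 (scal k p) = k * coord1 p /\
  coord2 (scal k p) = k * coord2 p /\ coord3 (scal k p) = k * coord3 p.
Proof. now repeat split. Qed.

Lemma R3_ext (p q : R3) : coord1 p = coord1 q -> coord2 p = coord2 q ->
  coord3 p = coord3 q -> p = q.
Proof.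
  destruct p as [[a b] c], q as [[a' b'] c']. unfold coord1, coord2, coord3. simpl.
  now intros -> -> ->.
Qed.

Lemma dot_sym p q : dot p q = dot q p.
Proof. unfold dot; ring. Qed.

Lemma dot_plus_l p q r : dot (plus p q) r = dot p r + dot q r.
Proof. unfold dot. destruct (coord_plus p q) as (-> & -> & ->). ring. Qed.

Lemma dot_scal_l k p r : dot (scal k p) r = k * dot p r.
Proof. unfold dot. destruct (coord_scal k p) as (-> & -> & ->). ring. Qed.

Lemma dot_plus_r p q r : dot r (plus p q) = dot r p + dot r q.
Proof. now rewrite !(dot_sym r), dot_plus_l. Qed.

Lemma dot_scal_r k p r : dot r (scal k p) = k * dot r p.
Proof. now rewrite !(dot_sym r), dot_scal_l. Qed.

(** Testing against every [r] turns an identity between linear combinations of vectors into one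
    between reals, within reach of [ring]. *)
Lemma dot_ext p q : (forall r, dot p r = dot q r) -> p = q.
Proof.
  intros H. generalize (H (1, 0, 0)) (H (0, 1, 0)) (H (0, 0, 1)).
  unfold dot.  intros H1 H2 H3.
  apply R3_ext; unfold coord1, coord2, coord3 in *; simpl in *; lra.
Qed.

Lemma dot_pos p : 0 <= dot p p.
Proof.
  unfold dot. generalize (Rle_0_sqr (coord1 p)) (Rle_0_sqr (coord2 p)) (Rle_0_sqr (coord3 p)).
  unfold Rsqr. lra.
Qed.

Lemma norm3_sqr p : norm3 p * norm3 p = dot p p.
Proof. apply sqrt_sqrt, dot_pos. Qed.

Lemma dot_eq0 p : dot p p = 0 -> p = zero.
Proof.
  unfold dot. intros H.
  generalize (Rle_0_sqr (coord1 p)) (Rle_0_sqr (coord2 p)) (Rle_0_sqr (coord3 p)).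
  unfold Rsqr. intros. apply R3_ext; apply Rsqr_0_uniq; unfold Rsqr; lra.
Qed.

Lemma norm3_neq0 p : p <> zero -> norm3 p <> 0.
Proof. intros H E. apply H, dot_eq0. rewrite <- norm3_sqr, E. ring. Qed.

(** [velocity] is built on the total function [Derive] and so carries no differentiability; this
    relation does. *)
Definition is_velocity (gamma : R -> R3) (t : R) (w : R3) : Prop :=
  is_derive (fun s => coord1 (gamma s)) t (coord1 w) /\
  is_derive (fun s => coord2 (gamma s)) t (coord2 w) /\
  is_derive (fun s => coord3 (gamma s)) t (coord3 w).

Lemma is_velocity_unique gamma t w : is_velocity gamma t w -> velocity gamma t = w.
Proof. intros (H1 & H2 & H3). apply R3_ext; now apply is_derive_unique. Qed.

Lemma is_velocity_ext_loc gamma delta t w : locally t (fun s => gamma s = delta s) ->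
  is_velocity gamma t w -> is_velocity delta t w.
Proof.
  intros E (H1 & H2 & H3). split; [|split].
  - refine (is_derive_ext_loc _ _ _ _ _ H1). refine (filter_imp _ _ _ E). now intros s ->.
  - refine (is_derive_ext_loc _ _ _ _ _ H2). refine (filter_imp _ _ _ E). now intros s ->.
  - refine (is_derive_ext_loc _ _ _ _ _ H3). refine (filter_imp _ _ _ E). now intros s ->.
Qed.

Lemma is_derive_dot gamma delta t v w : is_velocity gamma t v -> is_velocity delta t w ->
  is_derive (fun s => dot (gamma s) (delta s)) t (dot v (delta t) + dot (gamma t) w).
Proof.
  intros (H1 & H2 & H3) (K1 & K2 & K3). unfold dot.
  evar_last.
  - apply (is_derive_plus (K := R_AbsRing) (V := R_NormedModule));
      [apply (is_derive_plus (K := R_AbsRing) (V := R_NormedModule))|];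
      apply Derive.is_derive_mult; eassumption.
  - unfold plus; simpl; ring.
Qed.

Lemma is_velocity_plus gamma delta t v w : is_velocity gamma t v -> is_velocity delta t w ->
  is_velocity (fun s => plus (gamma s) (delta s)) t (plus v w).
Proof.
  intros (H1 & H2 & H3) (K1 & K2 & K3).
  split; [|split]; now apply (is_derive_plus (K := R_AbsRing) (V := R_NormedModule)).
Qed.

Lemma is_velocity_scal (k : R -> R) gamma t (k' : R) w :
  is_derive k t k' -> is_velocity gamma t w ->
  is_velocity (fun s => scal (k s) (gamma s)) t (plus (scal k' (gamma t)) (scal (k t) w)).
Proof.
  intros Hk (H1 & H2 & H3).
  split; [|split]; now apply Derive.is_derive_mult.
Qed.

Lemma class_C3_partials n (W : R * R -> Prop) phi : open W -> class_C3 (S n) W phi ->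
  class_C3 n W (partial_u phi) /\ class_C3 n W (partial_v phi).
Proof.
  intros HW (H1 & H2 & H3).
  apply class_C_partials in H1 as (_ & ? & ?), H2 as (_ & ? & ?), H3 as (_ & ? & ?);
    trivial. now repeat split.
Qed.

Lemma is_velocity_curve n (W : R * R -> Prop) phi u v t u' v' :
  open W -> class_C3 (S n) W phi ->
  W (u t, v t) -> is_derive u t u' -> is_derive v t v' ->
  is_velocity (fun s => phi (u s, v s)) t
    (plus (scal u' (partial_u phi (u t, v t))) (scal v' (partial_v phi (u t, v t)))).
Proof.
  intros HW (H1 & H2 & H3) Ht Hu Hv.
  apply class_C_partials in H1 as (? & _), H2 as (? & _), H3 as (? & _); trivial.
  split; [|split].
  - apply (has_grad_curve (fun q => coord1 (phi q))); auto.
  - apply (has_grad_curve (fun q => coord2 (phi q))); auto.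
  - apply (has_grad_curve (fun q => coord3 (phi q))); auto.
Qed.

Lemma is_velocity_partials n (W : R * R -> Prop) phi p :
  open W -> class_C3 (S n) W phi -> W p ->
  is_velocity (fun x => phi (x, snd p)) (fst p) (partial_u phi p) /\
  is_velocity (fun y => phi (fst p, y)) (snd p) (partial_v phi p).
Proof.
  intros HW (H1 & H2 & H3) Hp.
  apply class_C_partials in H1 as (H1 & _), H2 as (H2 & _), H3 as (H3 & _); trivial.
  generalize (has_grad_partials _ _ _ _ (H1 p Hp)) (has_grad_partials _ _ _ _ (H2 p Hp))
    (has_grad_partials _ _ _ _ (H3 p Hp)).
  intros (A1 & B1) (A2 & B2) (A3 & B3).
  exact (conj (conj A1 (conj A2 A3)) (conj B1 (conj B2 B3))).
Qed.

Lemma class_C3_Schwarz (W : R * R -> Prop) phi p : open W -> class_C3 2 W phi -> W p ->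
  partial_u (partial_v phi) p = partial_v (partial_u phi) p.
Proof.
  intros HW (H1 & H2 & H3) Hp.
  apply R3_ext;
    [ exact (class_C_Schwarz W (fun q => coord1 (phi q)) p HW H1 Hp)
    | exact (class_C_Schwarz W (fun q => coord2 (phi q)) p HW H2 Hp)
    | exact (class_C_Schwarz W (fun q => coord3 (phi q)) p HW H3 Hp) ].
Qed.

Lemma class_C_dot n (W : R * R -> Prop) phi psi : class_C3 n W phi -> class_C3 n W psi ->
  class_C n W (fun p => dot (phi p) (psi p)).
Proof.
  intros (H1 & H2 & H3) (K1 & K2 & K3). unfold dot.
  repeat apply class_C_plus; now apply class_C_mult.
Qed.

(** * The first fundamental form *)

(** By the fundamental theorem of calculus each integrand is recovered at 0 as the derivative of its
    integral with respect to the upper limit. *)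
Lemma RInt_eq_eq (h1 h2 : R -> R) (eps : posreal) :
  (forall t, Rabs t < eps -> continuous h1 t) ->
  (forall t, Rabs t < eps -> continuous h2 t) ->
  (forall a b, Rabs a < eps -> Rabs b < eps -> a <= b -> RInt h1 a b = RInt h2 a b) ->
  h1 0 = h2 0.
Proof.
  intros C1 C2 H. destruct eps as [eps He]; simpl in *.
  (* The lower limit lies strictly left of 0, so that upper limits on either side of 0 and close to
     it satisfy [a <= b]. *)
  set (a := - (eps / 2)).
  assert (D : forall h : R -> R, (forall t, Rabs t < eps -> continuous h t) ->
    is_derive (RInt (V := R_CompleteNormedModule) h a) 0 (h 0)).
  { intros h Ch. apply is_derive_RInt with a.
    - exists (mkposreal eps He). intros b Hb.
      apply (RInt_correct (V := R_CompleteNormedModule)),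
        (ex_RInt_continuous (V := R_CompleteNormedModule)). intros z Hz. apply Ch.
      unfold ball in Hb; simpl in Hb; unfold AbsRing_ball, abs, minus, plus, opp in Hb; simpl in Hb.
      apply Rabs_def2 in Hb. unfold Rmin, Rmax, a in Hz.
      destruct (Rle_dec (- (eps / 2)) b); apply Rabs_def1; lra.
    - apply Ch. rewrite Rabs_R0. trivial. }
  rewrite <- (is_derive_unique _ _ _ (D h1 C1)), <- (is_derive_unique _ _ _ (D h2 C2)).
  apply Derive_ext_loc. assert (He2 : 0 < eps / 2) by lra.
  exists (mkposreal _ He2). intros b Hb.
  unfold ball in Hb; simpl in Hb; unfold AbsRing_ball, abs, minus, plus, opp in Hb; simpl in Hb.
  apply Rabs_def2 in Hb. apply H; unfold a; try apply Rabs_def1; lra.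
Qed.

Lemma class_C3_tangent_vector n (W : R * R -> Prop) phi a b : open W -> class_C3 (S n) W phi ->
  class_C3 n W (tangent_vector phi a b).
Proof.
  intros HW H. apply class_C3_partials in H as ((U1 & U2 & U3) & (V1 & V2 & V3)); trivial.
  assert (K : forall f g, class_C n W f -> class_C n W g ->
    class_C n W (fun p => a * f p + b * g p)).
  { intros f g Hf Hg. apply class_C_plus; apply class_C_mult; trivial; apply class_C_const. }
  split; [|split]; now apply K.
Qed.

Lemma is_velocity_line n (W : R * R -> Prop) phi p d t :
  open W -> class_C3 (S n) W phi -> W (line p d t) ->
  is_velocity (fun s => phi (line p d s)) t (tangent_vector phi (fst d) (snd d) (line p d t)).
Proof.
  intros HW H Ht.
  apply (is_velocity_curve n W phi (fun s => fst p + s * fst d) (fun s => snd p + s * snd d));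
    trivial; apply line_is_derive.
Qed.

Lemma continuous_speed_line (W : R * R -> Prop) phi p d t :
  open W -> class_C3 1 W phi -> W (line p d t) ->
  continuous (fun s => norm3 (velocity (fun r => phi (line p d r)) s)) t.
Proof.
  intros HW H Ht.
  apply (continuous_ext_loc _ (fun s => norm3 (tangent_vector phi (fst d) (snd d) (line p d s)))).
  - generalize (open_line W p d HW t Ht). apply filter_imp. intros s Hs.
    now rewrite (is_velocity_unique _ _ _ (is_velocity_line 0 W phi p d s HW H Hs)).
  - apply continuous_sqrt_comp.
    apply (continuous_comp (line p d)
      (fun q => dot (tangent_vector phi (fst d) (snd d) q) (tangent_vector phi (fst d) (snd d) q))).
    + apply line_continuous.
    + assert (K := class_C3_tangent_vector 0 W phi (fst d) (snd d) HW H).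
      exact (class_C_dot 0 W _ _ K K _ Ht).
Qed.

Lemma line_0 p d : line p d 0 = p.
Proof. destruct p; unfold line; simpl. now rewrite !Rmult_0_l, !Rplus_0_r. Qed.

(** The line through [p] with direction [(a, b)] has this tangent vector as its velocity at time 0.
    Its short pieces have the same length on both surfaces, so [RInt_eq_eq] equates the speeds at
    time 0. *)
Lemma isometry_norm_tangent_vector (S S' : surface) (f : pt S -> pt S') c a b p :
  isometry S S' f -> atlas S c -> dom c p ->
  norm3 (tangent_vector (fun q => immersion S (param c q)) a b p)
  = norm3 (tangent_vector (fun q => immersion S' (f (param c q))) a b p).
Proof.
  intros Hf Hc Hp. set (d := (a, b)).
  set (phi := fun q => immersion S (param c q)).
  set (phi' := fun q => immersion S' (f (param c q))).
  assert (HW := atlas_open S c Hc).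
  assert (C : class_C3 1 (dom c) phi) by now apply class_C3_chart.
  assert (C' : class_C3 1 (dom c) phi') by (apply class_C3_smooth_map; trivial; apply Hf).
  rewrite <- (line_0 p d) in Hp |- *.
  destruct (open_line _ p d HW 0 Hp) as [eps Heps].
  assert (I : forall t, Rabs t < eps -> dom c (line p d t)).
  { intros t Ht. apply Heps. unfold ball; simpl; unfold AbsRing_ball, abs, minus, plus, opp; simpl.
    now rewrite Ropp_0, Rplus_0_r. }
  change (norm3 (tangent_vector phi (fst d) (snd d) (line p d 0))
    = norm3 (tangent_vector phi' (fst d) (snd d) (line p d 0))).
  rewrite <- (is_velocity_unique _ _ _ (is_velocity_line 0 _ phi p d 0 HW C Hp)).
  rewrite <- (is_velocity_unique _ _ _ (is_velocity_line 0 _ phi' p d 0 HW C' Hp)).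
  apply (RInt_eq_eq (fun t => norm3 (velocity (fun s => phi (line p d s)) t))
    (fun t => norm3 (velocity (fun s => phi' (line p d s)) t)) eps).
  - intros t Ht. now apply (continuous_speed_line (dom c)), I.
  - intros t Ht. now apply (continuous_speed_line (dom c)), I.
  - intros x y Hx Hy Hxy. symmetry.
    apply (proj2 Hf (Finite (- eps)) (Finite eps) (fun t => param c (line p d t)));
      try (apply Rabs_def2 in Hx, Hy; split; simpl; tauto || lra); trivial.
    apply smooth_curve_line; trivial. intros t [H1 H2]. apply I, Rabs_def1; trivial.
Qed.

Definition same_first_form (W : R * R -> Prop) (phi phi' : R * R -> R3) : Prop :=
  forall p, W p ->
    dot (partial_u phi p) (partial_u phi p) = dot (partial_u phi' p) (partial_u phi' p) /\
    dot (partial_u phi p) (partial_v phi p) = dot (partial_u phi' p) (partial_v phi' p) /\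
    dot (partial_v phi p) (partial_v phi p) = dot (partial_v phi' p) (partial_v phi' p).

Lemma isometry_same_first_form (S S' : surface) (f : pt S -> pt S') c :
  isometry S S' f -> atlas S c ->
  same_first_form (dom c) (fun q => immersion S (param c q))
    (fun q => immersion S' (f (param c q))).
Proof.
  intros Hf Hc p Hp.
  set (phi := fun q => immersion S (param c q)).
  set (phi' := fun q => immersion S' (f (param c q))).
  assert (Q : forall x y, dot (tangent_vector phi x y p) (tangent_vector phi x y p)
    = dot (tangent_vector phi' x y p) (tangent_vector phi' x y p)).
  { intros x y. rewrite <- !norm3_sqr. unfold phi, phi'.
    now rewrite (isometry_norm_tangent_vector S S' f). }
  (* Polarization: the values of the quadratic form at these three vectors determine its three
     coefficients. *)
  generalize (Q 1 0) (Q 0 1) (Q 1 1). unfold tangent_vector.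
  rewrite !dot_plus_l, !dot_plus_r, !dot_scal_l, !dot_scal_r.
  rewrite (dot_sym (partial_v phi p) (partial_u phi p)).
  rewrite (dot_sym (partial_v phi' p) (partial_u phi' p)).
  intros E G F. repeat split; lra.
Qed.

Lemma partials_dot n (W : R * R -> Prop) X Y p :
  open W -> class_C3 (S n) W X -> class_C3 (S n) W Y -> W p ->
  Derive_u (fun q => dot (X q) (Y q)) p = dot (partial_u X p) (Y p) + dot (X p) (partial_u Y p) /\
  Derive_v (fun q => dot (X q) (Y q)) p = dot (partial_v X p) (Y p) + dot (X p) (partial_v Y p).
Proof.
  intros HW HX HY Hp.
  destruct (is_velocity_partials n W X p HW HX Hp) as (Xu & Xv).
  destruct (is_velocity_partials n W Y p HW HY Hp) as (Yu & Yv).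
  generalize (is_derive_unique _ _ _ (is_derive_dot _ _ _ _ _ Xu Yu))
    (is_derive_unique _ _ _ (is_derive_dot _ _ _ _ _ Xv Yv)).
  destruct p as [x y]. intros E1 E2. exact (conj E1 E2).
Qed.

Lemma partials_ext_open (W : R * R -> Prop) f g p :
  open W -> (forall q, W q -> f q = g q) -> W p ->
  Derive_u f p = Derive_u g p /\ Derive_v f p = Derive_v g p.
Proof.
  intros HW E Hp. assert (L := HW p Hp).
  assert (L2 : locally_2d (fun x y => W (x, y)) (fst p) (snd p)).
  { apply locally_2d_locally. rewrite <- surjective_pairing. revert L.
    apply filter_imp. now intros [x y]. }
  split; apply Derive_ext_loc.
  - generalize (locally_2d_1d_const_y _ _ _ L2). apply filter_imp. intros x. apply E.
  - generalize (locally_2d_1d_const_x _ _ _ L2). apply filter_imp. intros y. apply E.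
Qed.

(* The Christoffel symbols of the first kind, [phi_i . phi_jk], are obtained by
   differentiating the first fundamental form. *)
Lemma same_first_form_Christoffel (W : R * R -> Prop) phi phi' p : open W ->
  class_C3 2 W phi -> class_C3 2 W phi' -> same_first_form W phi phi' -> W p ->
  (dot (partial_u (partial_u phi) p) (partial_u phi p)
   = dot (partial_u (partial_u phi') p) (partial_u phi' p) /\
   dot (partial_v (partial_u phi) p) (partial_u phi p)
   = dot (partial_v (partial_u phi') p) (partial_u phi' p) /\
   dot (partial_v (partial_v phi) p) (partial_u phi p)
   = dot (partial_v (partial_v phi') p) (partial_u phi' p)) /\
  (dot (partial_u (partial_u phi) p) (partial_v phi p)
   = dot (partial_u (partial_u phi') p) (partial_v phi' p) /\
   dot (partial_v (partial_u phi) p) (partial_v phi p)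
   = dot (partial_v (partial_u phi') p) (partial_v phi' p) /\
   dot (partial_v (partial_v phi) p) (partial_v phi p)
   = dot (partial_v (partial_v phi') p) (partial_v phi' p)).
Proof.
  intros HW C C' H Hp.
  destruct (class_C3_partials 1 W phi HW C) as (Cu & Cv).
  destruct (class_C3_partials 1 W phi' HW C') as (Cu' & Cv').
  assert (D : forall X Y X' Y', class_C3 1 W X -> class_C3 1 W Y ->
    class_C3 1 W X' -> class_C3 1 W Y' ->
    (forall q, W q -> dot (X q) (Y q) = dot (X' q) (Y' q)) ->
    dot (partial_u X p) (Y p) + dot (partial_u Y p) (X p)
    = dot (partial_u X' p) (Y' p) + dot (partial_u Y' p) (X' p) /\
    dot (partial_v X p) (Y p) + dot (partial_v Y p) (X p)
    = dot (partial_v X' p) (Y' p) + dot (partial_v Y' p) (X' p)).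
  { intros X Y X' Y' HX HY HX' HY' E.
    destruct (partials_dot 0 W X Y p HW HX HY Hp) as (E1 & E2).
    destruct (partials_dot 0 W X' Y' p HW HX' HY' Hp) as (E1' & E2').
    rewrite !(dot_sym (partial_u Y p)), !(dot_sym (partial_u Y' p)),
      !(dot_sym (partial_v Y p)), !(dot_sym (partial_v Y' p)).
    rewrite <- E1, <- E2, <- E1', <- E2'. now apply (partials_ext_open W). }
  destruct (D _ _ _ _ Cu Cu Cu' Cu' (fun q Hq => proj1 (H q Hq))) as (Eu & Ev).
  destruct (D _ _ _ _ Cu Cv Cu' Cv' (fun q Hq => proj1 (proj2 (H q Hq)))) as (Fu & Fv).
  destruct (D _ _ _ _ Cv Cv Cv' Cv' (fun q Hq => proj2 (proj2 (H q Hq)))) as (Gu & Gv).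
  (* Once the mixed derivatives are identified, the system is triangular: [Eu], [Ev], [Gu], [Gv]
     each give one product directly, and [Fu], [Fv] then give phi_uu . phi_v and phi_vv . phi_u. *)
  rewrite (class_C3_Schwarz W phi p HW C Hp), (class_C3_Schwarz W phi' p HW C' Hp) in Fu, Gu.
  repeat split; lra.
Qed.

(** * Osculating curves *)

(** The second derivative of s -> phi(u(s), v(s)) by the chain rule, where [u1], [v1] stand for the
    first and [u2], [v2] for the second derivatives of u and v. The factor 2 merges the two mixed
    derivatives. *)
Definition accel (phi : R * R -> R3) (p : R * R) (u1 v1 u2 v2 : R) : R3 :=
  plus (plus (scal u2 (partial_u phi p)) (scal v2 (partial_v phi p)))
    (plus (scal (u1 * u1) (partial_u (partial_u phi) p))
      (plus (scal (2 * u1 * v1) (partial_v (partial_u phi) p))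
        (scal (v1 * v1) (partial_v (partial_v phi) p)))).

Lemma same_first_form_accel (W : R * R -> Prop) phi phi' p u1 v1 u2 v2 : open W ->
  class_C3 2 W phi -> class_C3 2 W phi' -> same_first_form W phi phi' -> W p ->
  dot (accel phi p u1 v1 u2 v2) (partial_u phi p)
  = dot (accel phi' p u1 v1 u2 v2) (partial_u phi' p) /\
  dot (accel phi p u1 v1 u2 v2) (partial_v phi p)
  = dot (accel phi' p u1 v1 u2 v2) (partial_v phi' p).
Proof.
  intros HW C C' H Hp. unfold accel. rewrite !dot_plus_l, !dot_scal_l.
  destruct (same_first_form_Christoffel W phi phi' p HW C C' H Hp)
    as ((-> & -> & ->) & (-> & -> & ->)).
  rewrite !(dot_sym (partial_v _ _) (partial_u _ _)).
  destruct (H p Hp) as (-> & -> & ->). now split.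
Qed.

Lemma is_velocity_tangent_vector (W : R * R -> Prop) phi (u v u1 v1 : R -> R) t u2 v2 :
  open W ->
  class_C3 2 W phi -> W (u t, v t) ->
  is_derive u t (u1 t) -> is_derive v t (v1 t) ->
  is_derive u1 t u2 -> is_derive v1 t v2 ->
  is_velocity (fun s => tangent_vector phi (u1 s) (v1 s) (u s, v s)) t
    (accel phi (u t, v t) (u1 t) (v1 t) u2 v2).
Proof.
  intros HW C Ht Hu Hv Hu1 Hv1.
  destruct (class_C3_partials 1 W phi HW C) as (Cu & Cv).
  assert (Du := is_velocity_curve 0 W _ u v t _ _ HW Cu Ht Hu Hv).
  assert (Dv := is_velocity_curve 0 W _ u v t _ _ HW Cv Ht Hu Hv).
  refine (eq_ind _ (is_velocity _ t)
    (is_velocity_plus _ _ _ _ _ (is_velocity_scal _ _ _ _ _ Hu1 Du)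
      (is_velocity_scal _ _ _ _ _ Hv1 Dv)) _ _).
  rewrite (class_C3_Schwarz W phi _ HW C Ht).
  unfold accel. apply dot_ext. intros r.
  rewrite !dot_plus_l, !dot_scal_l, !dot_plus_l, !dot_scal_l. ring.
Qed.

(** The triple product expansion T x (X x Y) = (T . Y) X - (T . X) Y, paired with [alpha]. *)
Lemma dot_cross_cross alpha T X Y :
  dot alpha (cross T (cross X Y)) = dot alpha X * dot T Y - dot alpha Y * dot T X.
Proof. unfold dot, cross, coord1, coord2, coord3; simpl; ring. Qed.

(** Lagrange's identity: for X = phi_u and Y = phi_v it gives EG - F^2, so the normalizing factor of
    the unit normal is intrinsic. *)
Lemma dot_cross_self X Y :
  dot (cross X Y) (cross X Y) = dot X X * dot Y Y - dot X Y * dot X Y.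
Proof. unfold dot, cross, coord1, coord2, coord3; simpl; ring. Qed.

Lemma cross_scal_r k p q : cross p (scal k q) = scal k (cross p q).
Proof.
  unfold cross. destruct (coord_scal k q) as (-> & -> & ->).
  apply R3_ext; unfold coord1, coord2, coord3, scal; simpl;
  unfold scal; simpl; unfold mult; simpl; ring.
Qed.

Lemma same_first_form_component (W : R * R -> Prop) phi phi' p a b x x' :
  same_first_form W phi phi' -> W p ->
  dot x (partial_u phi p) = dot x' (partial_u phi' p) ->
  dot x (partial_v phi p) = dot x' (partial_v phi' p) ->
  dot x (cross (tangent_vector phi a b p) (unit_normal phi p))
  = dot x' (cross (tangent_vector phi' a b p) (unit_normal phi' p)).
Proof.
  intros H Hp Eu Ev. unfold unit_normal, normalize, norm3, tangent_vector.
  rewrite !cross_scal_r, !dot_scal_r, !dot_cross_self, !dot_cross_cross.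
  rewrite !dot_plus_l, !dot_scal_l, !(dot_sym (partial_v _ _) (partial_u _ _)).
  rewrite Eu, Ev. destruct (H p Hp) as (-> & -> & ->). reflexivity.
Qed.

(* If [x = l1 t + l2 n] along the unit speed curve [x], then [x . x' = l1], and
   differentiating gives [l1' = 1 + l2 kappa] where [kappa = |x''|]. *)
Lemma osculating_unit_speed (I : R -> Prop) l1 l2 gamma vel acc : open I ->
  (forall s, I s -> is_velocity gamma s (vel s)) ->
  (forall s, I s -> is_velocity vel s (acc s)) ->
  unit_speed I gamma -> osculating_with I l1 l2 gamma ->
  forall s, I s ->
    norm3 (acc s) <> 0 /\
    gamma s = plus (scal (l1 s) (vel s)) (scal (l2 s / norm3 (acc s)) (acc s)) /\
    is_derive l1 s (1 + l2 s * norm3 (acc s)).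
Proof.
  intros HI Hv Ha Hu Ho.
  assert (V : forall s, I s -> velocity gamma s = vel s)
    by (intros s Hs; now apply is_velocity_unique, Hv).
  assert (N : forall s, I s -> norm3 (vel s) = 1)
    by (intros s Hs; rewrite <- V; auto).
  assert (T : forall s, I s -> unit_tangent gamma s = vel s).
  { intros s Hs. unfold unit_tangent, normalize. rewrite V, N, Rinv_1; trivial.
    apply (scal_one (K := R_Ring)
      (V := prod_ModuleSpace _ (prod_ModuleSpace _ R_ModuleSpace R_ModuleSpace) R_ModuleSpace)). }
  assert (A : forall s, I s -> velocity (unit_tangent gamma) s = acc s).
  { intros s Hs. apply is_velocity_unique. apply (is_velocity_ext_loc vel); [|now apply Ha].
    (* Differentiating the unit tangent at [s] requires its equality with [vel] on a neighbourhood
       of [s], which the open [I] provides. *)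
    apply (locally_open I); trivial. intros r Hr. now rewrite T. }
  assert (NZ : forall s, I s -> norm3 (acc s) <> 0).
  { intros s Hs. apply norm3_neq0. rewrite <- A; trivial. now apply Ho. }
  assert (G : forall s, I s ->
    gamma s = plus (scal (l1 s) (vel s)) (scal (l2 s / norm3 (acc s)) (acc s))).
  { intros s Hs. destruct (Ho s Hs) as (_ & E).
    unfold principal_normal, normalize in E. rewrite A, T in E by trivial.
    rewrite E at 1. apply dot_ext. intros r. rewrite !dot_plus_l, !dot_scal_l.
    unfold Rdiv. ring. }
  assert (VV : forall s, I s -> dot (vel s) (vel s) = 1)
    by (intros s Hs; rewrite <- norm3_sqr, N; trivial; ring).
  (* Obtained by differentiating [VV], the constancy of vel . vel. *)
  assert (AV : forall s, I s -> dot (acc s) (vel s) = 0).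
  { intros s Hs. assert (D := is_derive_dot _ _ _ _ _ (Ha s Hs) (Ha s Hs)).
    rewrite (dot_sym (vel s)) in D. apply is_derive_unique in D.
    rewrite (Derive_ext_loc _ (fun _ => 1)), Derive_const in D; [lra|].
    apply (locally_open I); trivial. }
  intros s Hs. split; [now apply NZ|]. split; [now apply G|].
  (* Nothing is assumed about the regularity of [l1]: its differentiability comes from its equality
     near [s] with gamma . vel. *)
  apply (is_derive_ext_loc (fun r => dot (gamma r) (vel r))).
  - apply (locally_open I); trivial. intros r Hr.
    rewrite (G r Hr), dot_plus_l, !dot_scal_l, VV, AV by trivial.
    now rewrite Rmult_1_r, Rmult_0_r, Rplus_0_r.
  - evar_last.
    + apply is_derive_dot; [now apply Hv | now apply Ha].
    (* The term vel . vel contributes the 1; in gamma . acc only the part along [acc] survives,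
       which is (l2 / kappa) kappa^2. *)
    + rewrite (G s Hs), dot_plus_l, !dot_scal_l, VV, (dot_sym (vel s)), AV by trivial.
      rewrite <- (norm3_sqr (acc s)). field. now apply NZ.
Qed.

Theorem theorem4p2 :
  forall (S S' : surface) (f : pt S -> pt S'),
  isometry S S' f ->
  forall c : chart (pt S), atlas S c ->
  forall (lo hi : Rbar) (u v : R -> R),
  smooth1 (Rbar_interval lo hi) u ->
  smooth1 (Rbar_interval lo hi) v ->
  (forall s, Rbar_interval lo hi s -> dom c (u s, v s)) ->
  let phi := fun p => immersion S (param c p) in
  let phi' := fun p => immersion S' (f (param c p)) in
  let alpha := fun s => phi (u s, v s) in
  let alpha' := fun s => phi' (u s, v s) in
  unit_speed (Rbar_interval lo hi) alpha ->
  osculating_pair (Rbar_interval lo hi) alpha alpha' ->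
  forall s a b : R, Rbar_interval lo hi s ->
  dot (alpha s)
      (cross (tangent_vector phi a b (u s, v s))
             (unit_normal phi (u s, v s)))
  = dot (alpha' s)
        (cross (tangent_vector phi' a b (u s, v s))
               (unit_normal phi' (u s, v s))).
Proof.
  intros S S' f Hf c Hc lo hi u v Hu Hv Huv phi phi' alpha alpha' Hunit
    (l1 & l2 & Ho & Ho') s a b Hs.
  set (I := Rbar_interval lo hi) in *.
  assert (HI : open I) by apply open_Rbar_interval.
  assert (HW := atlas_open S c Hc).
  assert (C : forall n, class_C3 n (dom c) phi) by (intros n; now apply class_C3_chart).
  assert (C' : forall n, class_C3 n (dom c) phi')
    by (intros n; apply class_C3_smooth_map; trivial; apply Hf).
  assert (F : same_first_form (dom c) phi phi') by now apply isometry_same_first_form.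
  assert (Du : forall t, I t -> is_derive u t (Derive u t))
    by (intros t Ht; apply Derive_correct, (Hu 1%nat t Ht)).
  assert (Dv : forall t, I t -> is_derive v t (Derive v t))
    by (intros t Ht; apply Derive_correct, (Hv 1%nat t Ht)).
  assert (DDu : forall t, I t -> is_derive (Derive u) t (Derive (Derive u) t))
    by (intros t Ht; apply Derive_correct, (Hu 2%nat t Ht)).
  assert (DDv : forall t, I t -> is_derive (Derive v) t (Derive (Derive v) t))
    by (intros t Ht; apply Derive_correct, (Hv 2%nat t Ht)).
  (* [vel] and [acc] take the patch as a parameter: the two curves share the coordinates [u], [v]
     and their derivatives, and differ only in the patch. *)
  set (vel := fun psi t => tangent_vector psi (Derive u t) (Derive v t) (u t, v t)).
  set (acc := fun psi t => accel psi (u t, v t) (Derive u t) (Derive v t)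
    (Derive (Derive u) t) (Derive (Derive v) t)).
  assert (V : forall psi, class_C3 2 (dom c) psi -> forall t, I t ->
    is_velocity (fun r => psi (u r, v r)) t (vel psi t)).
  { intros psi Cpsi t Ht. apply (is_velocity_curve 1 (dom c)); auto. }
  assert (A : forall psi, class_C3 2 (dom c) psi -> forall t, I t ->
    is_velocity (vel psi) t (acc psi t)).
  { intros psi Cpsi t Ht. apply (is_velocity_tangent_vector (dom c)); auto. }
  (* Unit speed is given for [alpha] only; it passes to [alpha'] because the two velocities are
     corresponding tangent vectors. *)
  assert (Hunit' : unit_speed I alpha').
  { intros t Ht. rewrite <- (Hunit t Ht).
    rewrite (is_velocity_unique alpha _ _ (V phi (C _) t Ht)),
      (is_velocity_unique alpha' _ _ (V phi' (C' _) t Ht)).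
    symmetry. apply isometry_norm_tangent_vector; auto. }
  destruct (osculating_unit_speed I l1 l2 alpha (vel phi) (acc phi) HI
    (V phi (C _)) (A phi (C _)) Hunit Ho s Hs) as (K & E & D).
  destruct (osculating_unit_speed I l1 l2 alpha' (vel phi') (acc phi') HI
    (V phi' (C' _)) (A phi' (C' _)) Hunit' Ho' s Hs) as (K' & E' & D').
  assert (L : l2 s / norm3 (acc phi s) = l2 s / norm3 (acc phi' s)).
  (* [D] and [D'] compute the derivative of the same function [l1]. Where [l2 s] is 0 the curvatures
     may differ, but both quotients are then 0. *)
  { apply is_derive_unique in D, D'.
    assert (Q : l2 s * norm3 (acc phi s) = l2 s * norm3 (acc phi' s)) by lra.
    destruct (Req_dec (l2 s) 0) as [->|Hl].
    - unfold Rdiv. now rewrite !Rmult_0_l.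
    - apply Rmult_eq_reg_l in Q; trivial. now rewrite Q. }
  destruct (same_first_form_accel (dom c) phi phi' (u s, v s) (Derive u s) (Derive v s)
    (Derive (Derive u) s) (Derive (Derive v) s) HW (C _) (C' _) F (Huv s Hs)) as (Au & Av).
  (* It remains to compare the products with phi_u and phi_v. The acceleration terms agree by [Au]
     and [Av]; the velocity terms left over reduce to the first fundamental form. *)
  apply (same_first_form_component (dom c)); auto; rewrite E, E', L;
    rewrite !dot_plus_l, !dot_scal_l; f_equal; try (f_equal; assumption);
    f_equal; unfold vel, tangent_vector; rewrite !dot_plus_l, !dot_scal_l;
    destruct (F _ (Huv s Hs)) as (F1 & F2 & F3).
  - now rewrite !(dot_sym (partial_v _ _)), F1, F2.
  - now rewrite F2, F3.
Qed.
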